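(* Let $A$ be the generator of a $C_0$-semigroup $(e^{tA})_{t\ge 0}$ on a complex Banach space $X$. Then the following are equivalent: (i) $A$ is bounded; (ii) for every bounded linear projection $P$ on $X$ (i.e. bounded linear $P:X\to X$ with $P^2=P$), every $x\in X$ and every $t\ge 0$, the limit $\lim_{n\to\infty}(e^{\frac{t}{n}A}P)^n x$ exists in $X$ (in norm). *)

(* Defs.v *)
From HB Require Import structures.
From mathcomp Require Import all_boot all_order all_algebra.
From mathcomp Require Import all_classical all_reals all_analysis.
From mathcomp Require Export complex.
Export Order.TTheory GRing.Theory Num.Theory.
Export numFieldNormedType.Exports.
Set Implicit Arguments. Unset Strict Implicit. Unset Printing Implicit Defensive.
Local Open Scope ring_scope.
Local Open Scope classical_set_scope.

Section C0.
Variables (R : realType) (X : completeNormedModType R[i]).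

(* (T t)_{t >= 0} is a C_0-semigroup of bounded C-linear operators on X
   (values of T at t < 0 are irrelevant). *)
Definition is_C0_semigroup (T : R -> {linear X -> X}) : Prop :=
  [/\ (forall t, 0 <= t -> continuous (T t)),
      (forall x, T 0 x = x),
      (forall s t, 0 <= s -> 0 <= t -> forall x, T (s + t) x = T s (T t x)) &
      (forall x, T t x @[t --> 0^'+] --> x)].

Definition diffquot (T : R -> {linear X -> X}) (x : X) : R -> X :=
  fun h => ((h^-1)%:C)%C *: (T h x - x).

Definition gen_domain (T : R -> {linear X -> X}) : set X :=
  [set x | cvg (diffquot T x @ 0^'+)].
Definition generator (T : R -> {linear X -> X}) (x : X) : X :=
  lim (diffquot T x @ 0^'+).

Definition generator_bounded (T : R -> {linear X -> X}) : Prop :=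
  gen_domain T = setT /\
  exists M : R, forall x : X, `|generator T x| <= (M%:C)%C * `|x|.

Definition bounded_projection (P : {linear X -> X}) : Prop :=
  continuous P /\ forall x, P (P x) = P x.
End C0.

(* Main.v *)
Require Import Defs.
From HB Require Import structures.
From mathcomp Require Import all_boot all_order all_algebra.
From mathcomp Require Import all_classical all_reals all_analysis.
From mathcomp Require Import complex ring lra.
Import Order.TTheory GRing.Theory Num.Theory.
Import numFieldNormedType.Exports.
Local Open Scope ring_scope.
Local Open Scope classical_set_scope.

(** For bounded [A], write [T (t/n) = 1 + B_n/n]. The increments [B_n] are
    uniformly bounded and [B_n - B_(nm) = O(1/n)] in norm, because
    [T (t/n) = (1 + B_(nm)/(nm))^m]. As
    [P (T (t/n) P)^n = (1 + P B_n/n)^n P], the product is an Euler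
    approximation, and refining the step from [1/n] to [1/(nm)] shows that it is
    Cauchy.

    Conversely, a rank-one projection [P = f(.) y] with [f(y) = 1] yields
    [f((T (1/n) P)^n y) = f(T (1/n) y)^n = (1 + f(B_n y)/n)^n], so convergence
    bounds [Re f(B_n y)] from above. The normalisation [f(y) = 1] is free: one may
    add to [y] a multiple of some [u] with [f(u) <> 0] and [B_n u] bounded (averages of
    orbits provide such [u]). Applying this to [f] and [-f], two uses of uniform
    boundedness give [sup_n |B_n| < oo]; then [B_n] converges in norm and its limit is the
    generator. *)

Set Implicit Arguments. Unset Strict Implicit. Unset Printing Implicit Defensive.
Local Notation "a **: x" := ((a%:C)%C *: x) (at level 40).

(** * The norm as a real number *)

Section RealNorm.
Variables (R : realType) (X : normedModType R[i]).
Implicit Types (x y : X) (a : R).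

(** Norms over [R[i]] take values in [R[i]]. Their real part carries all the information and allows
    ordered real arithmetic. *)
Definition rnorm x : R := complex.Re `|x|.

Lemma normE x : `|x| = ((rnorm x)%:C)%C.
Proof. by rewrite /rnorm RRe_real // ger0_real. Qed.

Lemma rnorm_ge0 x : 0 <= rnorm x.
Proof. by rewrite -ler0c -normE. Qed.

Lemma rnorm0 : rnorm 0 = 0.
Proof. by rewrite /rnorm normr0. Qed.

Lemma rnorm0_eq0 x : rnorm x = 0 -> x = 0.
Proof. by move=> x0; apply/normr0_eq0; rewrite normE x0. Qed.

Lemma rnormN x : rnorm (- x) = rnorm x.
Proof. by rewrite /rnorm normrN. Qed.

Lemma rnormBC x y : rnorm (x - y) = rnorm (y - x).
Proof. by rewrite -rnormN opprB. Qed.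

Lemma rnormD x y : rnorm (x + y) <= rnorm x + rnorm y.
Proof. by rewrite -lecR rmorphD /= -!normE ler_normD. Qed.

Lemma rnormB x y : rnorm (x - y) <= rnorm x + rnorm y.
Proof. by rewrite -[rnorm y]rnormN rnormD. Qed.

Lemma rnorm_triangle y x z : rnorm (x - z) <= rnorm (x - y) + rnorm (y - z).
Proof. by apply: le_trans (rnormD _ _); rewrite addrA subrK. Qed.

Lemma rnorm_complexZ (c : R[i]) x : rnorm (c *: x) = complex.Re `|c| * rnorm x.
Proof.
by have := normrZ c x; rewrite !normE -rmorphM => /complexI.
Qed.

Lemma rnormZ a x : rnorm (a **: x) = `|a| * rnorm x.
Proof.
rewrite rnorm_complexZ; congr (_ * _).
by rewrite normc_def /= expr0n /= addr0 sqrtr_sqr.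
Qed.

Lemma rnorm_sum (I : Type) (r : seq I) (P : pred I) (F : I -> X) :
  rnorm (\sum_(i <- r | P i) F i) <= \sum_(i <- r | P i) rnorm (F i).
Proof.
elim/big_ind2 : _ => [|x a y b xa yb|//]; first by rewrite rnorm0.
exact: le_trans (rnormD _ _) (lerD xa yb).
Qed.

Lemma rscalerA a b x : a **: (b **: x) = (a * b) **: x.
Proof. by rewrite scalerA rmorphM. Qed.

Lemma rscale_nat k x : x *+ k = k%:R **: x.
Proof. by rewrite -scaler_nat rmorph_nat. Qed.

Lemma cvg_rnormP {T : Type} (F : set_system T) {FF : Filter F} (u : T -> X) l :
  u @ F --> l <-> rnorm (u t - l) @[t --> F] --> 0.
Proof.
split=> [/cvgrPdist_lt ul|/cvgrPdist_lt ul].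
  apply/cvgrPdist_lt => e e0.
  have e0' : 0 < (e%:C)%C :> R[i] by rewrite ltcR.
  have := ul _ e0'; apply: filterS => t.
  by rewrite normE ltcR sub0r normrN rnormBC ger0_norm // rnorm_ge0.
apply/cvgrPdist_lt => e e0.
have er : e = ((complex.Re e)%:C)%C by rewrite RRe_real // gtr0_real.
have e0' : 0 < complex.Re e by rewrite -ltcR -er.
have := ul _ e0'; apply: filterS => t.
rewrite sub0r normrN ger0_norm ?rnorm_ge0// => h.
by rewrite normE er ltcR rnormBC.
Qed.

Lemma ler_cvg0 {T : Type} (F : set_system T) {FF : ProperFilter F}
    (e : T -> R) (a b : R) :
  e @ F --> 0 -> (\forall t \near F, a <= b + e t) -> a <= b.
Proof.
move=> e0 ab; have : (b + e t) @[t --> F] --> b + 0 by apply: cvgD => //; exact: cvg_cst.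
rewrite addr0 => h; rewrite -(cvg_lim _ h)//; apply: limr_ge => //.
by apply/cvg_ex; exists b.
Qed.

Lemma squeeze0 {T : Type} (F : set_system T) {FF : Filter F} (f g : T -> R) :
  (\forall t \near F, 0 <= f t <= g t) -> g @ F --> 0 -> f @ F --> 0.
Proof. by move=> fg g0; apply: squeeze_cvgr g0; [exact: fg|exact: cvg_cst]. Qed.

Lemma cvg_divn (K : R) : K / n%:R @[n --> \oo] --> 0.
Proof.
apply/cvgrPdist_lt => e e0; exists (Num.truncn (`|K| / e)).+1 => // n /= hn.
have n0 : (0 : R) < n%:R by rewrite ltr0n; apply: leq_trans hn.
rewrite sub0r normrN normrM normfV (@ger0_norm _ n%:R)// ltr_pdivrMr// mulrC.
rewrite -ltr_pdivrMr//; apply: lt_le_trans (_ : (Num.truncn (`|K| / e)).+1%:R <= _).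
  exact: truncnS_gt.
by rewrite ler_nat.
Qed.

(** The finitely many early terms are absorbed by the sum of their absolute values. *)
Lemma eventually_bounded (a : nat -> R) n0 C :
  (forall n, (n0 <= n)%N -> a n <= C) -> exists D, forall n, a n <= D.
Proof.
move=> aC; exists (`|C| + \sum_(i < n0) `|a i|) => n.
have [nn0|nn0] := leqP n0 n.
  rewrite (le_trans (aC _ nn0))// (le_trans (ler_norm _))// lerDl.
  by apply: sumr_ge0 => i _.
rewrite (le_trans (ler_norm _))// (bigD1 (Ordinal nn0))//= addrCA lerDl.
by rewrite addr_ge0// sumr_ge0// => i _.
Qed.

Lemma linear_continuousP (f : {linear X -> X}) :
  continuous f <-> exists2 M, 0 <= M & forall x, rnorm (f x) <= M * rnorm x.
Proof.
rewrite -linear_bounded_continuous linear_boundedP; split.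
  move=> /pinfty_ex_gt0[M M0 fM]; exists (complex.Re M).
    by move: M0; rewrite ltcE => /andP[_ /ltW].
  have MR : ((complex.Re M)%:C)%C = M by apply: RRe_real; exact: gtr0_real.
  by move=> x; rewrite -lecR rmorphM /= -!normE MR; exact: fM.
move=> [M M0 fM]; exists (M%:C)%C; split=> [|r Mr x].
  by rewrite ger0_real// ler0c.
apply: le_trans (_ : (M%:C)%C * `|x| <= _); last by apply: ler_wpM2r => //; exact: ltW.
by rewrite !normE -rmorphM lecR.
Qed.

End RealNorm.

Section Complete.
Variables (R : realType) (X : completeNormedModType R[i]).

Lemma rnorm_complete (u : nat -> X) :
  (forall e, 0 < e -> exists n0, forall m n, (n0 <= m)%N -> (n0 <= n)%N ->
     rnorm (u m - u n) < e) ->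
  exists l : X, u @ \oo --> l.
Proof.
move=> cu; apply/cvg_ex; apply: cauchy_cvg; apply: cauchy_exP => e e0.
have er : e = ((complex.Re e)%:C)%C by rewrite RRe_real // gtr0_real.
have e0' : 0 < complex.Re e by rewrite -ltcR -er.
have [n0 h] := cu _ e0'; exists (u n0).
exists n0 => // n /= hn; rewrite -ball_normE /ball_/= normE er ltcR.
exact: h.
Qed.

End Complete.

(** * Uniform boundedness *)

Section UniformBoundedness.
Variable R : realType.

(* One of [s m], [s m + e m] has [q m]-size at least half of [q m (e m)], i.e.
   [3/8 * L m / 4^m]; the later terms remove at most [1/3 * L m / 4^m]. *)
Lemma gliding_hump (E : zmodType) (q : nat -> E -> R) (e : nat -> E) (L : nat -> R) :
  (forall k a b, q k (a - b) <= q k a + q k b) ->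
  (forall k j, q k (e j) <= L k / 4 ^+ j) ->
  (forall k, 3 / 4 * (L k / 4 ^+ k) <= q k (e k)) ->
  exists s : nat -> E, [/\ s 0%N = 0,
    (forall m, s m.+1 = s m \/ s m.+1 = s m + e m) &
    (forall k m, (k < m)%N -> L k / 4 ^+ k / 24 <= q k (s m))].
Proof.
move=> qB qle qge.
pose s := fix s m := if m is m'.+1 then
  if 3 / 8 * (L m' / 4 ^+ m') <= q m' (s m') then s m' else s m' + e m' else 0.
have p4 m : (0 : R) < (4 ^+ m)^-1 by rewrite invr_gt0 exprn_gt0.
have q_ge0 k : 0 <= q k 0.
  by have := qB k 0 0; rewrite subr0 => h; lra.
have L_ge0 k : 0 <= L k.
  have := le_trans (qge k) (qle k k).
  rewrite -(pmulr_lge0 _ (p4 k)) mulrC => h; lra.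
(* Induction invariant: [4 / 3 * (4 ^+ m)^-1] is the sum of [(4 ^+ j)^-1] over [j >= m], the loss
   still to come. At [d = 0] the bracket equals [3 / 8 * (4 ^+ k)^-1]. *)
have sge k d : L k * ((4 ^+ k)^-1 / 24 + 4 / 3 * (4 ^+ (k.+1 + d))^-1)
    <= q k (s (k.+1 + d)%N).
  elim: d => [|d IH].
    rewrite addn0 exprS invfM /=.
    have -> : L k * ((4 ^+ k)^-1 / 24 + 4 / 3 * (4^-1 * (4 ^+ k)^-1)) =
      3 / 8 * (L k / 4 ^+ k) by field; rewrite expf_neq0.
    case: ifPn => //; rewrite -ltNge => h.
    have := qB k (s k + e k) (s k); rewrite addrAC subrr add0r.
    by have := qge k => h1 h2; lra.
  rewrite addnS /=; set m := (k.+1 + d)%N in IH *.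
  rewrite exprS invfM.
  have h1 := qle k m; have p := mulr_ge0 (L_ge0 k) (ltW (p4 m)).
  case: ifPn => _.
    by lra.
  have := qB k (s m + e m) (e m); rewrite addrK => h2.
  by lra.
exists s; split=> // [m|k m km].
  by rewrite /=; case: ifPn => _; [left|right].
rewrite -(subnKC km); apply: le_trans (sge _ _).
rewrite -mulrA ler_wpM2l// lerDl mulr_ge0// ?ltW//; lra.
Qed.

(** A geometric series bounds the tails. An abstract seminorm [p] lets the result serve both vectors
    of [X] and the pointwise values of a sequence of functionals. *)
Lemma geometric_cauchy (E : zmodType) (p : E -> R) (A : R) (s : nat -> E) :
  p 0 = 0 -> (forall a, p (- a) = p a) -> (forall a b, p (a + b) <= p a + p b) ->
  0 <= A -> (forall m, p (s m.+1 - s m) <= A / 4 ^+ m) ->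
  (forall m d, p (s (m + d)%N - s m) <= 2 * A / 4 ^+ m) /\
  (forall e, 0 < e -> exists n0, forall m n, (n0 <= m)%N -> (n0 <= n)%N ->
     p (s m - s n) < e).
Proof.
move=> p0 pN pD A0 ps.
have p4 m : (0 : R) < (4 ^+ m)^-1 by rewrite invr_gt0 exprn_gt0.
have H m d : p (s (m + d)%N - s m) <= 4 / 3 * A * ((4 ^+ m)^-1 - (4 ^+ (m + d))^-1).
  elim: d => [|d IH]; first by rewrite addn0 !subrr mulr0 p0.
  have := pD (s (m + d.+1)%N - s (m + d)%N) (s (m + d)%N - s m).
  rewrite addrA subrK => h; apply: (le_trans h).
  have := ps (m + d)%N; rewrite -addnS => h2.
  have -> : (4 ^+ (m + d.+1))^-1 = (4 ^+ (m + d))^-1 / 4 :> R.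
    by rewrite addnS exprS invfM mulrC.
  by lra.
have H2 m d : p (s (m + d)%N - s m) <= 2 * A / 4 ^+ m.
  apply: le_trans (H m d) _.
  have h1 := mulr_ge0 A0 (ltW (p4 m)); have h2 := mulr_ge0 A0 (ltW (p4 (m + d)%N)).
  by lra.
split=> // e e0; have := cvg_divn (4 * A) => /cvgrPdist_lt/(_ _ e0)[n0 _ hn0].
exists n0.+1.
have H3 m n : (n0.+1 <= m)%N -> (m <= n)%N -> p (s n - s m) < e.
  move=> hm hn; rewrite -(subnKC hn); apply: le_lt_trans (H2 _ _) _.
  have := hn0 m (ltnW hm); rewrite /= sub0r normrN ger0_norm; last first.
    by rewrite mulr_ge0// mulr_ge0.
  apply: le_lt_trans; rewrite -!mulrA.
  (* The crude bound [m <= 4 ^+ m] reduces the geometric tail to [cvg_divn]. *)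
  have hle : (4 ^+ m)^-1 <= m%:R^-1 :> R.
    rewrite lef_pV2 ?posrE ?exprn_gt0// ?ltr0n ?(leq_trans _ hm)//.
    by rewrite -natrX ler_nat ltnW// ltn_expl.
  have h1 : A / 4 ^+ m <= A / m%:R by apply: ler_wpM2l.
  have h2 := mulr_ge0 A0 (ltW (p4 m)).
  by lra.
move=> m n hm hn; have [mn|/ltnW nm] := leqP m n; last exact: H3.
by rewrite -pN opprB; exact: H3.
Qed.

Section Operators.
Variable X : completeNormedModType R[i].

(** A gliding hump replaces the Baire category argument: if the operator norms were unbounded, a
    series of nearly norming vectors scaled by [4 ^- k] would converge to a point [l] at which the
    family is unbounded. *)
Lemma uniform_boundedness (F : nat -> {linear X -> X}) :
  (forall n, continuous (F n)) ->
  (forall x, exists C, forall n, rnorm (F n x) <= C) ->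
  exists2 C, 0 <= C & forall n x, rnorm (F n x) <= C * rnorm x.
Proof.
move=> Fc Fb; apply: contrapT => nC.
(* [sup (S n)] is the operator norm of [F n]. *)
pose S n := [set rnorm (F n x) | x in [set x | rnorm x <= 1]].
have S0 n : S n 0.
  by exists 0; rewrite /= ?linear0 rnorm0 ?ler01.
have Sub n : has_ubound (S n).
  have [M M0 FM] := (linear_continuousP (F n)).1 (Fc n).
  exists M => _ [x /= x1 <-]; apply: le_trans (FM x) _.
  by rewrite ler_piMr.
have leS n x : rnorm (F n x) <= sup (S n) * rnorm x.
  have [x0|x0] := eqVneq (rnorm x) 0.
    by rewrite (rnorm0_eq0 x0) linear0 rnorm0 mulr0.
  have xp : 0 < rnorm x by rewrite lt_def x0 rnorm_ge0.
  rewrite -ler_pdivrMr//.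
  have -> : rnorm (F n x) / rnorm x = rnorm (F n ((rnorm x)^-1 **: x)).
    by rewrite linearZ /= rnormZ mulrC ger0_norm// invr_ge0 ltW.
  apply: ub_le_sup => //; exists ((rnorm x)^-1 **: x) => //=.
  by rewrite rnormZ gtr0_norm ?invr_gt0// mulVf.
have supS0 n : 0 <= sup (S n).
  by apply: ub_le_sup => //; exact: S0.
(* The factor [24 * 4 ^+ k] cancels the loss in [gliding_hump], so that the value left at the limit
   is at least [k]. *)
have big k : exists n, 24 * k%:R * 4 ^+ k <= sup (S n).
  apply: contrapT => h; apply: nC; exists (24 * k%:R * 4 ^+ k).
    by rewrite !mulr_ge0// exprn_ge0.
  move=> n x; apply: le_trans (leS n x) _; rewrite ler_wpM2r ?rnorm_ge0//.
  by rewrite leNgt; apply/negP => hlt; apply: h; exists n; exact: ltW.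
have [nn hnn] := choice big.
have near k : exists x, rnorm x <= 1 /\ 3 / 4 * sup (S (nn k)) <= rnorm (F (nn k) x).
  have [s0|sn0] := eqVneq (sup (S (nn k))) 0.
    by exists 0; rewrite rnorm0 s0 mulr0 rnorm_ge0 ler01.
  have sp : 0 < sup (S (nn k)) by rewrite lt_def sn0 supS0.
  have s4 : 0 < sup (S (nn k)) / 4 by rewrite divr_gt0.
  have hs : has_sup (S (nn k)) by split=> //; exists 0.
  have [_ [x /= x1 <-] hx] := sup_adherent s4 hs.
  by exists x; split=> //; lra.
have [x hx] := choice near.
have [||| s [s0 sS sL]] := @gliding_hump X (fun k a => rnorm (F (nn k) a))
    (fun j => (4 ^+ j)^-1 **: x j) (fun k => sup (S (nn k))).
- by move=> k a b; rewrite linearB rnormB.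
- move=> k j; rewrite linearZ /= rnormZ ger0_norm ?invr_ge0 ?exprn_ge0// mulrC.
  rewrite ler_wpM2r ?invr_ge0 ?exprn_ge0//; apply: le_trans (leS _ _) _.
  by rewrite ler_piMr// (hx _).1.
- move=> k; rewrite linearZ /= rnormZ ger0_norm ?invr_ge0 ?exprn_ge0//.
  rewrite mulrA [leRHS]mulrC ler_wpM2r ?invr_ge0 ?exprn_ge0//.
  exact: (hx _).2.
have sSd m : rnorm (s m.+1 - s m) <= 1 / 4 ^+ m.
  case: (sS m) => ->; first by rewrite subrr rnorm0 divr_ge0// exprn_ge0.
  rewrite addrC addKr rnormZ ger0_norm ?invr_ge0 ?exprn_ge0// mulrC.
  by rewrite ler_wpM2r ?invr_ge0 ?exprn_ge0// (hx _).1.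
have [_ cs] := geometric_cauchy (@rnorm0 _ X) (@rnormN _ X) (@rnormD _ X) ler01 sSd.
have [l sl] := rnorm_complete cs.
have [C hC] := Fb l.
pose k := (Num.truncn C).+1.
have [M M0 FM] := (linear_continuousP (F (nn k))).1 (Fc (nn k)).
have : k%:R <= rnorm (F (nn k) l).
  apply: (@ler_cvg0 _ _ (nbhs \oo) _ (fun m => M * rnorm (s m - l))).
    rewrite -[0](mulr0 M); apply: cvgM; first exact: cvg_cst.
    exact/cvg_rnormP.
  exists k.+1 => // m /= km.
  have h1 : k%:R <= rnorm (F (nn k) (s m)).
    apply: le_trans (sL _ _ km); rewrite !ler_pdivlMr// ?exprn_gt0//.
    by rewrite [k%:R * 24]mulrC; exact: hnn.
  apply: le_trans h1 _; rewrite -{1}(subrK l (s m)) linearD addrC.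
  by apply: le_trans (rnormD _ _) _; rewrite lerD2l.
move=> /le_trans/(_ (hC _)); apply/negP; rewrite -ltNge; exact: truncnS_gt.
Qed.

End Operators.

End UniformBoundedness.

(** * Hahn-Banach and weakly bounded sequences *)

Section HahnBanach.
Variables (R : realType) (V : lmodType R[i]).
Implicit Types (p : V -> R) (x y : V).

Definition sublinear p :=
  (forall x y, p (x + y) <= p x + p y) /\
  (forall a x, 0 < a -> p (a **: x) <= a * p x).

Definition real_linear p :=
  (forall x y, p (x + y) = p x + p y) /\ (forall a x, p (a **: x) = a * p x).

Lemma rscale0r (x : V) : (0 : R) **: x = 0.
Proof. exact: scale0r. Qed.

Lemma rscale1r (x : V) : (1 : R) **: x = x.
Proof. exact: scale1r. Qed.

(** The missing inequality is the assumed one for the factor [a^-1] at the point [a **: x]. *)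
Lemma sublinearZ p a x : sublinear p -> 0 < a -> p (a **: x) = a * p x.
Proof.
move=> [_ pZ] a0; apply/eqP; rewrite eq_le pZ//= -ler_pdivlMl//.
rewrite (le_trans _ (pZ _ _ _)) ?invr_gt0// scalerA -rmorphM mulVf ?gt_eqF//.
by rewrite rscale1r.
Qed.

Lemma sublinear0 p : sublinear p -> p 0 = 0.
Proof.
move=> hp; have := sublinearZ 0 hp (ltr0Sn R 1); rewrite scaler0 => h; lra.
Qed.

Lemma sublinear_geN p x : sublinear p -> - p (- x) <= p x.
Proof.
move=> hp; have := hp.1 x (- x); rewrite subrr sublinear0// => h; lra.
Qed.

(* [shift p y] is a sublinear minorant of [p], and it is strictly below [p]
   wherever [p (x + y) < p x + p y]; hence a minimal [p] is additive. *)
Definition shift_set p y x :=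
  [set p (x + t **: y) - t * p y | t in [set t | 0 <= t]].

Definition shift p y x := inf (shift_set p y x).

Lemma shift_set_lb p y x : sublinear p -> lbound (shift_set p y x) (- p (- x)).
Proof.
move=> hp _ [t /= t0 <-].
have ty : p (t **: y) = t * p y.
  have [->|tn0] := eqVneq t 0; first by rewrite rscale0r sublinear0// mul0r.
  by rewrite sublinearZ// lt_def tn0.
by have := hp.1 (x + t **: y) (- x); rewrite addrAC subrr add0r ty => h; lra.
Qed.

Lemma shift_le p y x t : sublinear p -> 0 <= t ->
  shift p y x <= p (x + t **: y) - t * p y.
Proof.
move=> hp t0; apply: ge_inf; last by exists t.
by exists (- p (- x)); exact: shift_set_lb.
Qed.

Lemma shift_set0 p y x : shift_set p y x !=set0.
Proof. by eexists; exists 0; [exact: lexx|]. Qed.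

(** Parameters [t] at [x1] and [s] at [x2] are matched by [t + s] at [x1 + x2]; scaling by [a] turns
    [t] into [a * t]. *)
Lemma shift_sublinear p y : sublinear p -> sublinear (shift p y).
Proof.
move=> hp; split=> [x1 x2|a x a0].
  rewrite -lerBlDr; apply: lb_le_inf; first exact: shift_set0.
  move=> _ [t /= t0 <-]; rewrite lerBlDr -lerBlDl.
  apply: lb_le_inf; first exact: shift_set0.
  move=> _ [s /= s0 <-]; rewrite lerBlDl.
  apply: le_trans (shift_le _ _ hp (addr_ge0 t0 s0)) _.
  have := hp.1 (x1 + t **: y) (x2 + s **: y).
  by rewrite addrACA -scalerDl -rmorphD => h; lra.
rewrite -ler_pdivrMl//; apply: lb_le_inf; first exact: shift_set0.
move=> _ [t /= t0 <-]; rewrite ler_pdivrMl//.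
apply: le_trans (shift_le y _ hp (mulr_ge0 (ltW a0) t0)) _.
have -> : a **: x + (a * t) **: y = a **: (x + t **: y).
  by rewrite scalerDr scalerA -rmorphM.
by rewrite sublinearZ// mulrBr mulrA.
Qed.

Lemma minimal_sublinear_linear p : sublinear p ->
  (forall q, sublinear q -> (forall x, q x <= p x) -> q = p) -> real_linear p.
Proof.
move=> hp pmin.
have pD x y : p (x + y) = p x + p y.
  apply/eqP; rewrite eq_le hp.1/= -lerBrDr.
  have e : shift p y = p.
    apply: pmin => [|u]; first exact: shift_sublinear.
    by have := shift_le y u hp (lexx 0); rewrite rscale0r addr0 mul0r subr0.
  by have := shift_le y x hp ler01; rewrite e rscale1r mul1r.
have pN x : p (- x) = - p x.
  by have := pD x (- x); rewrite subrr sublinear0// => h; lra.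
split=> // a x; case: (ltgtP a 0) => [a0|a0|->].
- have Na : 0 < - a by rewrite oppr_gt0.
  by have := sublinearZ x hp Na; rewrite rmorphN /= scaleNr pN => h; lra.
- exact: sublinearZ.
- by rewrite rscale0r sublinear0// mul0r.
Qed.

(** Zorn's lemma is applied to the sublinear minorants of [p0], with [le_] reversed so that a
    maximal element is a pointwise minimal minorant, which is linear by [minimal_sublinear_linear].
    A chain is bounded by its pointwise infimum. *)
Lemma hahn_banach p0 : sublinear p0 ->
  exists p, real_linear p /\ forall x, p x <= p0 x.
Proof.
move=> hp0; pose Q p := sublinear p /\ forall x, p x <= p0 x.
pose le_ (p q : {p | Q p}) := `[< forall x, sval q x <= sval p x >].
have [||||[p [hp pp0]] pmin] := @Zorn {p | Q p} le_.
- by move=> p; apply/asboolP => x.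
- move=> p q r /asboolP pq /asboolP qr; apply/asboolP => x.
  exact: le_trans (qr x) (pq x).
- move=> [p hp] [q hq] /asboolP pq /asboolP qp; apply: eq_exist.
  by apply/funext => x; apply/le_anti/andP; split; [exact: qp|exact: pq].
- move=> A Atot.
  have [[q0 Aq0]|A0] := pselect (A !=set0); last first.
    by exists (exist Q p0 (conj hp0 (fun=> lexx _))) => s As; case: A0; exists s.
  pose S x := [set sval q x | q in A].
  have Slb x : has_lbound (S x).
    exists (- p0 (- x)) => _ [[q [hq qp0]] _ <-] /=.
    by apply: le_trans (sublinear_geN x hq); rewrite lerN2.
  have Sn x : S x !=set0 by exists (sval q0 x); exists q0.
  pose m x := inf (S x).
  have mle q x : A q -> m x <= sval q x.
    by move=> Aq; apply: ge_inf => //; exists q.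
  have hm : sublinear m.
    split=> [x y|a x a0].
      rewrite -lerBlDr; apply: lb_le_inf => // _ [q Aq <-].
      rewrite lerBlDr -lerBlDl; apply: lb_le_inf => // _ [r Ar <-].
      rewrite lerBlDl.
      (* Subadditivity of the infimum needs one member of the chain below both [q] and [r]; totality
         of the chain provides it. *)
      have [r' [Ar' r'q r'r]] : exists r', [/\ A r',
          (forall x, sval r' x <= sval q x) & (forall x, sval r' x <= sval r x)].
        by case: (Atot _ _ Aq Ar) => /asboolP h; [exists r|exists q]; split.
      apply: le_trans (mle r' _ Ar') _.
      by apply: le_trans ((svalP r').1.1 x y) _; exact: lerD.
    rewrite -ler_pdivrMl//; apply: lb_le_inf => // _ [q Aq <-].
    rewrite ler_pdivrMl//; apply: le_trans (mle q _ Aq) _.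
    exact: (svalP q).1.2.
  have mp0 x : m x <= p0 x by apply: le_trans (mle q0 x Aq0) ((svalP q0).2 x).
  exists (exist Q m (conj hm mp0)) => q Aq; apply/asboolP => x /=.
  exact: mle.
exists p; split=> //; apply: minimal_sublinear_linear => // q hq qp.
have Qq : Q q by split=> // x; exact: le_trans (qp x) (pp0 x).
by have /(_ _)/(congr1 sval) := pmin (exist Q q Qq); apply; apply/asboolP.
Qed.

End HahnBanach.

(** * Norming functionals and weak boundedness *)

Section Functionals.
Variables (R : realType) (X : normedModType R[i]).
Implicit Types (r : X -> R).

Definition real_functional (D : R) r :=
  real_linear r /\ forall x, `|r x| <= D * rnorm x.

Lemma real_linearN r x : real_linear r -> r (- x) = - r x.
Proof.
by move=> [_ rZ]; rewrite -scaleN1r -[-1 in LHS](rmorphN1 (real_complex R)) rZ mulN1r.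
Qed.

Lemma real_linearB r x y : real_linear r -> r (x - y) = r x - r y.
Proof. by move=> hr; rewrite hr.1 real_linearN. Qed.

(** Hahn-Banach is applied to the norm shifted along [z]. This shift is at most [- rnorm z] at
    [- z], which forces any linear minorant to be at least [rnorm z] at [z]. *)
Lemma norming_functional (z : X) :
  exists2 r, real_functional 1 r & r z = rnorm z.
Proof.
have hN : sublinear (@rnorm R X).
  split=> [x y|a x a0]; first exact: rnormD.
  by rewrite rnormZ gtr0_norm.
have [r [rl rle]] := hahn_banach (shift_sublinear z hN).
have rleN x : r x <= rnorm x.
  apply: le_trans (rle x) _.
  by have := shift_le z x hN (lexx 0); rewrite rscale0r addr0 mul0r subr0.
exists r.
  split=> // x; rewrite mul1r ler_norml rleN andbT lerNl -real_linearN//.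
  by rewrite -(rnormN x).
apply/eqP; rewrite eq_le rleN/= -lerN2 -real_linearN//.
apply: le_trans (rle _) _.
have := shift_le z (- z) hN ler01.
by rewrite rscale1r mul1r addNr rnorm0 sub0r.
Qed.

(** The gliding hump now runs through functionals: the seminorms are evaluations at [z (nn k)], and
    the humps are functionals norming these vectors, scaled by [4 ^- k]. The partial sums converge
    pointwise to a functional [g], bounded with constant [2] by [geometric_cauchy] started at
    [s 0 = 0], and [g] is unbounded along [z]. *)
Lemma weakly_bounded_bounded (z : nat -> X) :
  (forall D r, real_functional D r -> exists C, forall n, `|r (z n)| <= C) ->
  exists C, forall n, rnorm (z n) <= C.
Proof.
move=> zw; apply: contrapT => nC.
have big k : exists n, 24 * k%:R * 4 ^+ k <= rnorm (z n).
  apply: contrapT => h; apply: nC; exists (24 * k%:R * 4 ^+ k) => n.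
  by rewrite leNgt; apply/negP => hlt; apply: h; exists n; exact: ltW.
have [nn hnn] := choice big.
have /choice[f hf] : forall k, exists r,
    real_functional 1 r /\ r (z (nn k)) = rnorm (z (nn k)).
  by move=> k; have [r h1 h2] := norming_functional (z (nn k)); exists r.
have p4 m : (0 : R) <= (4 ^+ m)^-1 by rewrite invr_ge0 exprn_ge0.
have [||| s [s0 sS sL]] := @gliding_hump R (X -> R) (fun k r => `|r (z (nn k))|)
    (fun j x => (4 ^+ j)^-1 * f j x) (fun k => rnorm (z (nn k))).
- by move=> k a b; exact: ler_normB.
- move=> k j; rewrite normrM ger0_norm// mulrC ler_wpM2r//.
  by apply: le_trans ((hf j).1.2 _) _; rewrite mul1r.
- move=> k; rewrite (hf k).2 normrM !ger0_norm ?rnorm_ge0// mulrC.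
  have := mulr_ge0 (p4 k) (rnorm_ge0 (z (nn k))) => h; lra.
have slin m : real_linear (s m).
  elim: m => [|m IH]; first by rewrite s0; split=> [x y|a x]; rewrite ?addr0 ?mulr0.
  case: (sS m) => -> //; split=> [x y|a x] /=; rewrite !fctE.
    by rewrite IH.1 (hf m).1.1.1; ring.
  by rewrite IH.2 (hf m).1.1.2; ring.
have sSd x m : `|s m.+1 x - s m x| <= rnorm x / 4 ^+ m.
  case: (sS m) => ->; first by rewrite subrr normr0 divr_ge0 ?rnorm_ge0// exprn_ge0.
  rewrite fctE addrAC subrr add0r normrM ger0_norm// mulrC ler_wpM2r//.
  by rewrite -[leRHS]mul1r; exact: (hf m).1.2.
have geo x := @geometric_cauchy R R^o Num.norm _ (s ^~ x) (@normr0 _ _) (@normrN _ _)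
  (@ler_normD _ _) (rnorm_ge0 x) (sSd x).
have /choice[g hg] : forall x, exists l, s m x @[m --> \oo] --> (l : R).
  move=> x; apply/cvg_ex; apply: R_complete; apply: cauchy_exP => e e0.
  have [n0 h] := (geo x).2 _ e0; exists (s n0 x); exists n0 => // n /= hn.
  exact: h.
have gD x y : g (x + y) = g x + g y.
  rewrite -(cvg_lim _ (hg (x + y)))//; apply: cvg_lim => //.
  have -> : (fun m => s m (x + y)) = (fun m => s m x + s m y).
    by apply/funext => m; exact: (slin m).1.
  exact: cvgD.
have gZ a x : g (a **: x) = a * g x.
  rewrite -(cvg_lim _ (hg (a **: x)))//; apply: cvg_lim => //.
  have -> : (fun m => s m (a **: x)) = (fun m => a * s m x).
    by apply/funext => m; exact: (slin m).2.
  by apply: cvgM => //; exact: cvg_cst.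
have gn x : `|g x| <= 2 * rnorm x.
  have h : `|s m x| @[m --> \oo] --> `|g x| by exact: cvg_norm.
  rewrite -(cvg_lim _ h)//.
  apply: limr_le; first by apply/cvg_ex; exists `|g x|.
  near=> m; have := (geo x).1 0%N m.
  by rewrite s0 expr0 divr1 add0n subr0.
have [C hC] := zw 2 g (conj (conj gD gZ) gn).
pose k := (Num.truncn C).+1.
have : k%:R <= `|g (z (nn k))|.
  have h : `|s m (z (nn k))| @[m --> \oo] --> `|g (z (nn k))| by exact: cvg_norm.
  rewrite -(cvg_lim _ h)//.
  apply: limr_ge; first by apply/cvg_ex; exists `|g (z (nn k))|.
  exists k.+1 => // m /= km.
  apply: le_trans (sL _ _ km); rewrite !ler_pdivlMr// ?exprn_gt0//.
  by rewrite [k%:R * 24]mulrC; exact: hnn.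
move=> /le_trans/(_ (hC _)); apply/negP; rewrite -ltNge; exact: truncnS_gt.
Unshelve. all: by end_near. Qed.

End Functionals.

(** * Euler products *)

Section Increments.
Variables (R : realType) (X : normedModType R[i]).
Implicit Types (x y : X).

(** This is the remainder [e] of the binomial expansion of [(1 + b)^m] after its linear term. It
    satisfies [e_(m+1) = e_m + b (e_m + m b x)], and [m * beta <= 1] lets the cubic term
    [m^2 beta^3] be absorbed by [m beta^2]. *)
Lemma pow_estimate (b : {linear X -> X}) (beta : R) m x :
  0 <= beta -> (forall y, rnorm (b y) <= beta * rnorm y) -> m%:R * beta <= 1 ->
  rnorm (iter m (fun y => y + b y) x - x - m%:R **: b x)
    <= (m%:R * beta) ^+ 2 * rnorm x.
Proof.
move=> b0 hb; elim: m => [|m IH] hm.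
  by rewrite /= subrr rscale0r subrr rnorm0 mul0r expr0n mul0r.
have hm' : m%:R * beta <= 1.
  by apply: le_trans hm; rewrite ler_wpM2r// ler_nat.
have {IH} := IH hm'; rewrite iterS /=.
set y := iter m _ x; set e := y - x - _ => he.
have -> : y + b y - x - m.+1%:R **: b x = e + b (e + m%:R **: b x).
  rewrite {2}/e subrK linearB /e -natr1 rmorphD rmorph1 /= scalerDl scale1r.
  rewrite opprD !addrA; congr (_ - _); rewrite -!addrA; congr (_ + _).
  by rewrite addrC -addrA.
have h1 := hb (e + m%:R **: b x).
have h2 := rnormD e (m%:R **: b x); rewrite rnormZ ger0_norm// in h2.
have h3 := hb x; have h4 := rnormD e (b (e + m%:R **: b x)).
have x0 := rnorm_ge0 x; have e0 := rnorm_ge0 e.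
have m0 : (0 : R) <= m%:R by [].
rewrite -natr1 in hm *.
apply: le_trans h4 _.
apply: (@le_trans _ _ ((1 + beta) * rnorm e + m%:R * beta ^+ 2 * rnorm x)).
  have h5 := ler_wpM2l m0 h3; have h6 := ler_wpM2l b0 h5.
  have h7 := ler_wpM2l b0 h2.
  by move: h1 h6 h7; rewrite !expr2; lra.
have h8 : (1 + beta) * rnorm e <= (1 + beta) * ((m%:R * beta) ^+ 2 * rnorm x).
  by rewrite ler_wpM2l// addr_ge0.
have h9 : 0 <= m%:R * (beta ^+ 2) * rnorm x * (1 - m%:R * beta).
  by rewrite !mulr_ge0 ?exprn_ge0// subr_ge0.
have h10 : 0 <= beta ^+ 2 * rnorm x by rewrite mulr_ge0// exprn_ge0.
move: h8 h9 h10; set a := (m%:R : R); set c := rnorm x => h8 h9 h10.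
have : (1 + beta) * ((a * beta) ^+ 2 * c) + a * beta ^+ 2 * c
   + (a * beta ^+ 2 * c * (1 - a * beta)) + beta ^+ 2 * c = ((a + 1) * beta) ^+ 2 * c
   + ((a * beta) ^+ 2 * beta * c - a * beta ^+ 2 * c * (a * beta)) by ring.
have -> : (a * beta) ^+ 2 * beta * c - a * beta ^+ 2 * c * (a * beta) = 0 by ring.
by lra.
Qed.

Lemma iter_bound (S : X -> X) (al : R) n x :
  0 <= al -> (forall y, rnorm (S y) <= al * rnorm y) ->
  rnorm (iter n S x) <= al ^+ n * rnorm x.
Proof.
move=> al0 hS; elim: n => [|n IH]; first by rewrite mul1r.
by rewrite iterS exprS -mulrA; apply: le_trans (hS _) _; rewrite ler_wpM2l.
Qed.

(** Telescoping: [S^(n+1) - Q^(n+1) = S (S^n - Q^n) + (S - Q) Q^n]. Since [1 <= al], every term is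
    bounded with the same power of [al]. *)
Lemma iter_diff (S Q : X -> X) (al eta : R) n x :
  (forall y z, S (y - z) = S y - S z) -> 1 <= al -> 0 <= eta ->
  (forall y, rnorm (S y) <= al * rnorm y) ->
  (forall y, rnorm (Q y) <= al * rnorm y) ->
  (forall y, rnorm (S y - Q y) <= eta * rnorm y) ->
  rnorm (iter n S x - iter n Q x) <= n%:R * al ^+ n * eta * rnorm x.
Proof.
move=> SB al1 eta0 hS hQ hSQ; have al0 : 0 <= al by apply: le_trans al1.
elim: n => [|n IH]; first by rewrite subrr rnorm0 !mul0r.
rewrite !iterS; apply: le_trans (rnorm_triangle (S (iter n Q x)) _ _) _.
rewrite -SB; have h1 := le_trans (hS _) (ler_wpM2l al0 IH).
have h2 := le_trans (hSQ _) (ler_wpM2l eta0 (iter_bound n x al0 hQ)).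
have h3 : eta * (al ^+ n * rnorm x) <= eta * (al ^+ n.+1 * rnorm x).
  rewrite ler_wpM2l// ler_wpM2r ?rnorm_ge0// exprS ler_peMl// exprn_ge0//.
by move: h1 h2 h3; rewrite exprS -natr1; lra.
Qed.

(** For [a = n] and [S = T (t / n)] this is [B_n], that is, [t] times the difference quotient at
    [t / n] when [t] and [n] are positive. *)
Definition increment (a : R) (S : {linear X -> X}) : {linear X -> X} :=
  (a%:C)%C \*: (S \- idfun).

Lemma incrementE a S x : increment a S x = a **: (S x - x).
Proof. by []. Qed.

Lemma incrementK n (S : {linear X -> X}) x : (0 < n)%N ->
  S x = x + n%:R^-1 **: increment n%:R S x.
Proof.
move=> n0; rewrite incrementE rscalerA mulVf ?pnatr_eq0 -?lt0n// rscale1r.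
by rewrite addrC subrK.
Qed.

(* [m] steps of size [1/(nm)] agree with one step of size [1/n] up to [O(1/n^2)]. *)
Lemma increment_diff (S : nat -> {linear X -> X}) (C : R) n m x :
  0 <= C -> (forall y, S n y = iter m (S (n * m)%N) y) ->
  (forall k y, rnorm (increment k%:R (S k) y) <= C * rnorm y) ->
  (0 < n)%N -> (0 < m)%N ->
  rnorm (increment n%:R (S n) x - increment (n * m)%:R (S (n * m)%N) x)
    <= 2 * C ^+ 2 / n%:R * rnorm x.
Proof.
move=> C0 SM hC n0 m0; have nr : (0 : R) < n%:R by rewrite ltr0n.
have mr : (0 : R) < m%:R by rewrite ltr0n.
have x0 := rnorm_ge0 x.
(* For [n < C] the triangle inequality already gives [2 * C <= 2 * C ^+ 2 / n]. Otherwise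
   [C / n <= 1], as [pow_estimate] requires. *)
have [nC|Cn] := ltP n%:R C.
  apply: le_trans (rnormB _ _) _; apply: le_trans (lerD (hC _ _) (hC _ _)) _.
  rewrite -mulrDl ler_wpM2r// ler_pdivlMr// expr2.
  have := ler_wpM2l C0 (ltW nC); lra.
pose b : {linear X -> X} :=
  (((n * m)%:R^-1 : R)%:C)%C \*: increment (n * m)%:R (S (n * m)%N).
have hb y : rnorm (b y) <= (n * m)%:R^-1 * C * rnorm y.
  rewrite rnormZ ger0_norm ?invr_ge0// -mulrA ler_wpM2l ?invr_ge0//.
have nm : m%:R * ((n * m)%:R^-1 * C) = C / n%:R.
  by rewrite natrM; field; rewrite !gt_eqF.
have h0 : 0 <= (n * m)%:R^-1 * C by rewrite mulr_ge0// invr_ge0.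
have h1 : m%:R * ((n * m)%:R^-1 * C) <= 1 by rewrite nm ler_pdivrMr// mul1r.
have := pow_estimate x h0 hb h1; rewrite nm.
have -> : iter m (fun y => y + b y) x = S n x.
  rewrite SM; apply: eq_iter => y; rewrite [RHS](@incrementK (n * m))//.
  by rewrite muln_gt0 n0.
set B := increment _ (S (n * m)%N) x.
have -> : m%:R **: b x = n%:R^-1 **: B.
  by rewrite rscalerA -/B; congr (_ **: _); rewrite natrM; field; rewrite !gt_eqF.
move=> h; rewrite incrementE.
have -> : n%:R **: (S n x - x) - B = n%:R **: (S n x - x - n%:R^-1 **: B).
  by rewrite [RHS]scalerBr [in RHS]rscalerA mulfV ?gt_eqF// rscale1r.
rewrite rnormZ ger0_norm//; apply: le_trans (ler_wpM2l (ltW nr) h) _.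
have -> : n%:R * ((C / n%:R) ^+ 2 * rnorm x) = C ^+ 2 / n%:R * rnorm x.
  by field; rewrite gt_eqF.
rewrite ler_wpM2r// ler_wpM2r ?invr_ge0//.
have := exprn_ge0 2 C0; lra.
Qed.

End Increments.

Section Euler.
Variables (R : realType) (X : completeNormedModType R[i]).

(** Two indices [m] and [n] are compared through their common multiple [m * n]. *)
Lemma divisible_cauchy (u : nat -> X) :
  (forall e, 0 < e -> exists n0, forall n m, (n0 <= n)%N -> (0 < m)%N ->
     rnorm (u n - u (n * m)%N) < e) ->
  exists l : X, u @ \oo --> l.
Proof.
move=> h; apply: rnorm_complete => e e0.
have e2 : 0 < e / 2 by rewrite divr_gt0.
have [n0 hn] := h _ e2; exists n0.+1 => m n hm hn'.
apply: le_lt_trans (rnorm_triangle (u (m * n)%N) _ _) _.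
rewrite [e]splitr ltrD// ?hn ?(ltnW hm)//; first exact: leq_trans hn'.
by rewrite rnormBC mulnC hn ?(ltnW hn')// (leq_trans _ hm).
Qed.

(** One step of size [1/n] and [m] steps of size [1/(nm)] differ by [O(1/n^2)]; over [n] steps this
    accumulates to [O(1/n)]. The family [D] is abstract because it will be the compression [P B_n],
    which does not come from a semigroup in general. *)
Lemma euler_cvg (D : nat -> {linear X -> X}) (C K : R) x :
  0 <= C -> 0 <= K ->
  (forall n y, rnorm (D n y) <= C * rnorm y) ->
  (forall n m y, (0 < n)%N -> (0 < m)%N ->
     rnorm (D n y - D (n * m)%N y) <= K / n%:R * rnorm y) ->
  exists l : X, iter n (fun y => y + n%:R^-1 **: D n y) x @[n --> \oo] --> l.
Proof.
move=> C0 K0 hD hDD; pose S n y := y + n%:R^-1 **: D n y.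
(* The exponential bound is stable under refinement: [m] steps of size [1/(nm)] cost exactly as much
   as one of size [1/n]. *)
have hS n y : rnorm (S n y) <= expR (C / n%:R) * rnorm y.
  apply: le_trans (rnormD _ _) _; rewrite rnormZ ger0_norm ?invr_ge0//.
  apply: (@le_trans _ _ ((1 + C / n%:R) * rnorm y)).
    rewrite mulrDl mul1r lerD2l [C / _]mulrC -mulrA ler_wpM2l ?invr_ge0//.
  by rewrite ler_wpM2r ?rnorm_ge0// expR_ge1Dx.
apply: divisible_cauchy => e e0.
pose A := expR C * (K + C ^+ 2) * rnorm x.
have := cvg_divn A => /cvgrPdist_lt/(_ _ e0)[n0 _ hn0].
exists (maxn n0 (Num.truncn C).+1) => n m; rewrite geq_max => /andP[nn0 nC] m0.
have n0' : (0 < n)%N by apply: leq_trans nC.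
have nr : (0 : R) < n%:R by rewrite ltr0n.
have mr : (0 : R) < m%:R by rewrite ltr0n.
have Cn : C <= n%:R.
  by apply: le_trans (ltW (truncnS_gt C)) _; rewrite ler_nat.
have -> : iter (n * m) (fun y => y + (n * m)%:R^-1 **: D (n * m)%N y) x =
    iter n (iter m (S (n * m)%N)) x.
  by rewrite iterM.
have e1 : 1 <= expR (C / n%:R) by rewrite -expR0 ler_expR divr_ge0.
apply: le_lt_trans (@iter_diff _ _ (S n) _ (expR (C / n%:R))
   ((K + C ^+ 2) / n%:R ^+ 2) n x _ e1 _ (hS n) _ _) _.
- by move=> y z; rewrite /S linearB scalerBr opprD addrACA.
- by rewrite divr_ge0 ?addr_ge0 ?exprn_ge0.
- move=> y; apply: le_trans (iter_bound m y (expR_ge0 _) (hS _)) _.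
  rewrite -expRM_natl natrM.
  have -> : m%:R * (C / (n%:R * m%:R)) = C / n%:R by field; rewrite !gt_eqF.
  exact: lexx.
- move=> y.
  pose b := (((n * m)%:R^-1 : R)%:C)%C \*: D (n * m)%N : {linear X -> X}.
  have hb z : rnorm (b z) <= (n * m)%:R^-1 * C * rnorm z.
    by rewrite rnormZ ger0_norm ?invr_ge0// -mulrA ler_wpM2l ?invr_ge0.
  have nm : m%:R * ((n * m)%:R^-1 * C) = C / n%:R.
    by rewrite natrM; field; rewrite !gt_eqF.
  have h0 : 0 <= (n * m)%:R^-1 * C by rewrite mulr_ge0// invr_ge0.
  have h1 : m%:R * ((n * m)%:R^-1 * C) <= 1 by rewrite nm ler_pdivrMr// mul1r.
  have := pow_estimate y h0 hb h1; rewrite nm.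
  have -> : m%:R **: b y = n%:R^-1 **: D (n * m)%N y.
    by rewrite rscalerA; congr (_ **: _); rewrite natrM; field; rewrite !gt_eqF.
  (* The local error splits into the change from [D n] to [D (n * m)], which gives [K / n^2], and
     the second-order remainder, which gives [C^2 / n^2]. *)
  move=> h; have -> : S n y - iter m (S (n * m)%N) y =
     n%:R^-1 **: (D n y - D (n * m)%N y) -
     (iter m (S (n * m)%N) y - y - n%:R^-1 **: D (n * m)%N y).
    by rewrite /S scalerBr !opprB subrKA addrA [y + _]addrC.
  apply: le_trans (rnormB _ _) _.
  rewrite rnormZ ger0_norm ?invr_ge0//.
  have -> : (K + C ^+ 2) / n%:R ^+ 2 * rnorm y =
    n%:R^-1 * (K / n%:R * rnorm y) + (C / n%:R) ^+ 2 * rnorm y.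
    by field; rewrite gt_eqF.
  by apply: lerD => //; rewrite ler_wpM2l ?invr_ge0//; exact: hDD.
rewrite -expRM_natl.
have -> : n%:R * (C / n%:R) = C by field; rewrite gt_eqF.
have -> : n%:R * expR C * ((K + C ^+ 2) / n%:R ^+ 2) * rnorm x = A / n%:R.
  by rewrite /A; field; rewrite gt_eqF.
apply: le_lt_trans (hn0 n nn0); rewrite sub0r normrN; exact: ler_norm.
Qed.

End Euler.

(** * Bounded generators *)

Section Semigroup.
Variables (R : realType) (X : completeNormedModType R[i]).
Variables (T : R -> {linear X -> X}) (hT : is_C0_semigroup T).

Lemma near_rightP (P : R -> Prop) :
  (\forall h \near 0^'+, P h) <-> exists2 d : R, 0 < d & forall h, 0 < h < d -> P h.
Proof.
split=> [[d d0 hd]|[d d0 hd]]; exists d => //.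
  move=> h /andP[h0 hlt]; apply: hd => //=.
  by rewrite sub0r normrN gtr0_norm.
move=> h /= hlt h0; apply: hd; rewrite h0 /=.
by move: hlt; rewrite sub0r normrN gtr0_norm.
Qed.

Lemma semigroup_continuous t : 0 <= t -> continuous (T t).
Proof. by case: hT => h *; exact: h. Qed.

Lemma semigroup0 x : T 0 x = x.
Proof. by case: hT. Qed.

Lemma semigroupD s t x : 0 <= s -> 0 <= t -> T (s + t) x = T s (T t x).
Proof. by case: hT => _ _ h _ s0 t0; exact: h. Qed.

Lemma semigroup_iter n s x : 0 <= s -> T (n%:R * s) x = iter n (T s) x.
Proof.
move=> s0; elim: n => [|n IH]; first by rewrite mul0r semigroup0.
by rewrite iterS -IH -semigroupD ?mulr_ge0// -nat1r mulrDl mul1r.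
Qed.

Lemma semigroup_refine t n m x : 0 <= t -> (0 < m)%N ->
  T (t / n%:R) x = iter m (T (t / (n * m)%:R)) x.
Proof.
move=> t0 m0; rewrite -semigroup_iter ?divr_ge0//; congr (T _ x).
have mr : (m%:R : R) != 0 by rewrite pnatr_eq0 -lt0n.
(* At [n = 0] both times are [0], since the inverse of [0] is [0]. *)
have [->|n0] := eqVneq n 0%N; first by rewrite mul0n invr0 !mulr0.
by rewrite natrM; field; rewrite mr pnatr_eq0.
Qed.

Lemma semigroup_right0 (x : X) e : 0 < e ->
  exists2 d : R, 0 < d & forall s, 0 <= s < d -> rnorm (T s x - x) < e.
Proof.
case: hT => _ _ _ /(_ x)/cvg_rnormP/cvgrPdist_lt h e0.
have [d d0 hd] := (near_rightP _).1 (h _ e0); exists d => // s.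
case/andP; rewrite le_eqVlt => /predU1P[<- _|s0 sd].
  by rewrite semigroup0 subrr rnorm0.
by have := hd s; rewrite s0 sd sub0r normrN ger0_norm ?rnorm_ge0//; apply.
Qed.

Lemma increment_continuous (a : R) (S : {linear X -> X}) :
  continuous S -> continuous (increment a S).
Proof.
move=> /linear_continuousP[M M0 hM]; apply/linear_continuousP.
exists (`|a| * (M + 1)); first by rewrite mulr_ge0 ?addr_ge0.
move=> x; rewrite rnormZ -mulrA ler_wpM2l//.
by apply: le_trans (rnormB _ _) _; rewrite mulrDl mul1r; exact: lerD (hM x) (lexx _).
Qed.

Lemma increment_bounded_pointwise t x : 0 <= t -> gen_domain T x ->
  exists C, forall n, rnorm (increment n%:R (T (t / n%:R)) x) <= C.
Proof.
rewrite le_eqVlt => /predU1P[<- _|t0].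
  by exists 0 => n; rewrite mul0r incrementE semigroup0 subrr scaler0 rnorm0.
move=> /cvg_ex[l /cvg_rnormP/cvgrPdist_lt/(_ _ ltr01)/near_rightP[d d0 hd]].
apply: (@eventually_bounded _ _ (Num.truncn (t / d)).+1 (t * (1 + rnorm l))) => n hn.
have nr : (0 : R) < n%:R by rewrite ltr0n (leq_trans _ hn).
have tn : 0 < t / n%:R < d.
  rewrite divr_gt0//= ltr_pdivrMr// mulrC -ltr_pdivrMr//.
  by apply: lt_le_trans (truncnS_gt _) _; rewrite ler_nat.
have := hd _ tn; rewrite sub0r normrN ger0_norm ?rnorm_ge0// => h.
have -> : increment n%:R (T (t / n%:R)) x = t **: diffquot T x (t / n%:R).
  rewrite incrementE /diffquot rscalerA; congr (_ **: _).
  by field; rewrite !gt_eqF.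
rewrite rnormZ gtr0_norm// ler_wpM2l ?ltW//.
by rewrite -[diffquot _ _ _](subrK l) (le_lt_trans (rnormD _ _))// ltrD2r.
Qed.

Lemma increment_bounded t : 0 <= t -> gen_domain T = setT ->
  exists2 C, 0 <= C &
    forall n x, rnorm (increment n%:R (T (t / n%:R)) x) <= C * rnorm x.
Proof.
move=> t0 dT; apply: uniform_boundedness => [n|x].
  by apply: increment_continuous; apply: semigroup_continuous; rewrite divr_ge0.
by apply: increment_bounded_pointwise => //; rewrite dT.
Qed.

(** Since [P] fixes its range, compressing [S = 1 + B/n] to that range gives [1 + P B/n]. *)
Lemma projection_compression (P S : {linear X -> X}) n k x :
  (forall y, P (P y) = P y) -> (0 < n)%N ->
  P (iter k (S \o P) x) =
  iter k (fun y => y + n%:R^-1 **: (P \o increment n%:R S : {linear X -> X}) y) (P x).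
Proof.
move=> PP n0; elim: k => [//|k IH]; rewrite !iterS -IH /=.
by rewrite [in LHS](incrementK S _ n0) linearD PP linearZ.
Qed.

Lemma projected_product_cvg (P : {linear X -> X}) x t :
  gen_domain T = setT -> bounded_projection P -> 0 <= t ->
  cvgn (fun n : nat => iter n (T (t / n%:R) \o P) x).
Proof.
move=> dT [/linear_continuousP[M M0 hM] PP] t0.
have [C C0 hC] := increment_bounded t0 dT.
pose B n : {linear X -> X} := increment n%:R (T (t / n%:R)).
pose D n : {linear X -> X} := P \o B n.
have hD n y : rnorm (D n y) <= M * C * rnorm y.
  by apply: le_trans (hM _) _; rewrite -mulrA; apply: ler_wpM2l => //; exact: hC.
have hDD n m y : (0 < n)%N -> (0 < m)%N ->
    rnorm (D n y - D (n * m)%N y) <= M * (2 * C ^+ 2) / n%:R * rnorm y.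
  move=> n0 m0; rewrite /D /= -linearB; apply: le_trans (hM _) _.
  have SM z : T (t / n%:R) z = iter m (T (t / (n * m)%:R)) z.
    exact: semigroup_refine.
  have := @increment_diff R X (fun k => T (t / k%:R)) C n m y C0 SM hC n0 m0.
  by move=> /(ler_wpM2l M0) h; apply: le_trans h _; rewrite !mulrA.
have MC0 : 0 <= M * C by rewrite mulr_ge0.
have MK0 : 0 <= M * (2 * C ^+ 2) by rewrite !mulr_ge0// exprn_ge0.
have [l hl] := euler_cvg (P x) MC0 MK0 hD hDD.
apply/cvg_ex; exists l; apply/cvg_rnormP.
(* [v n] is [P] applied to the product. With [w] equal to [P] applied to the first [n - 1] factors,
   the product is [T (t / n) w] and [v n] is [P (T (t / n) w)]; as [P w = w], they differ by
   [O(1/n)]. *)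
pose v n := iter n (fun y => y + n%:R^-1 **: D n y) (P x).
pose A := (C + M * C) * (expR (M * C) * rnorm (P x)).
apply: (@squeeze0 _ _ _ _ _ (fun n => A / n%:R + rnorm (v n - l))); last first.
  by rewrite -[0]addr0; apply: cvgD; [exact: cvg_divn|exact/cvg_rnormP].
exists 1%N => // n /= n0; rewrite rnorm_ge0 /=.
have nr : (0 : R) < n%:R by rewrite ltr0n.
apply: le_trans (rnorm_triangle (v n) _ _) _; rewrite lerD2r.
rewrite /v -(projection_compression (T (t / n%:R)) n x PP n0).
rewrite -[in iter n](prednK n0) !iterS /=; set w := P (iter _ _ _).
have -> : T (t / n%:R) w - P (T (t / n%:R) w) = n%:R^-1 **: (B n w - D n w).
  have hTw : T (t / n%:R) w = w + n%:R^-1 **: B n w by exact: incrementK.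
  have -> : P (T (t / n%:R) w) = w + n%:R^-1 **: D n w.
    by rewrite hTw linearD linearZ {1}/w PP.
  by rewrite hTw opprD addrACA subrr add0r -scalerBr.
have hw : rnorm w <= expR (M * C) * rnorm (P x).
  rewrite /w (projection_compression (T (t / n%:R)) _ x PP n0).
  have hS y : rnorm (y + n%:R^-1 **: D n y) <= expR (M * C / n%:R) * rnorm y.
    apply: le_trans (rnormD _ _) _; rewrite rnormZ ger0_norm ?invr_ge0//.
    apply: (@le_trans _ _ ((1 + M * C / n%:R) * rnorm y)).
      by rewrite mulrDl mul1r lerD2l [_ / _]mulrC -mulrA ler_wpM2l ?invr_ge0.
    by rewrite ler_wpM2r ?rnorm_ge0// expR_ge1Dx.
  apply: le_trans (iter_bound n.-1 (P x) (expR_ge0 _) hS) _.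
  rewrite ler_wpM2r ?rnorm_ge0// -expRM_natl ler_expR mulrCA ler_piMr//.
  by rewrite ler_pdivrMr// mul1r ler_nat leq_pred.
rewrite rnormZ ger0_norm ?invr_ge0// mulrC ler_wpM2r ?invr_ge0//.
apply: le_trans (rnormB _ _) _; apply: le_trans (lerD (hC _ _) (hD _ _)) _.
by rewrite -mulrDl ler_wpM2l// addr_ge0.
Qed.

End Semigroup.

(** * Rearrangement of finite sums *)

Section SumShift.
Variable V : zmodType.

(** The sum of the first [k + p] terms is split once after [k] terms and once after [p] terms. *)
Lemma sum_shift (F : nat -> V) k p :
  \sum_(j < k) F (j + p)%N - \sum_(j < k) F j =
  \sum_(i < p) F (k + i)%N - \sum_(i < p) F i.
Proof.
have split_sum m n :
    \sum_(i < m + n) F i = \sum_(i < m) F i + \sum_(i < n) F (m + i)%N.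
  by rewrite big_split_ord.
have h : \sum_(j < k) F j + \sum_(i < p) F (k + i)%N =
    \sum_(i < p) F i + \sum_(j < k) F (j + p)%N.
  under [X in _ = _ + X]eq_bigr do rewrite addnC.
  by rewrite -!split_sum addnC.
by apply/eqP; rewrite subr_eq addrAC eq_sym subr_eq addrC h addrC.
Qed.

Lemma sum_mul (F : nat -> V) k m :
  \sum_(l < k * m) F l = \sum_(j < k) \sum_(i < m) F (j * m + i)%N.
Proof.
elim: k => [|k IH]; first by rewrite !big_ord0.
rewrite big_ord_recr -IH /= mulSnr.
by rewrite big_split_ord.
Qed.

End SumShift.

(** * Convergence forces a bounded generator *)

Section LocalBound.
Variables (R : realType) (X : completeNormedModType R[i]).
Variables (T : R -> {linear X -> X}) (hT : is_C0_semigroup T).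

(** Otherwise there are times [s k <= 1/(k+1)] at which the norm of [T (s k)] exceeds [k]. Right
    continuity at [0] makes these operators pointwise bounded, against uniform boundedness. *)
Lemma semigroup_local_bound : exists d M : R, [/\ 0 < d, 0 <= M &
  forall s x, 0 <= s <= d -> rnorm (T s x) <= M * rnorm x].
Proof.
apply: contrapT => nb.
have /choice[s hs] : forall k : nat, exists s : R,
    0 <= s <= k.+1%:R^-1 /\ exists x, k%:R * rnorm x < rnorm (T s x).
  move=> k; apply: contrapT => h; apply: nb; exists k.+1%:R^-1, k%:R.
  split=> // s x hs.
  rewrite leNgt; apply/negP => hx; apply: h; exists s; split=> //.
  by exists x.
have [||C C0 hC] := @uniform_boundedness R X (fun k => T (s k)).
- by move=> k; apply: (semigroup_continuous hT); case/andP: (hs k).1.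
- move=> x; have [d d0 hd] := semigroup_right0 hT x ltr01.
  apply: (@eventually_bounded _ _ (Num.truncn d^-1).+1 (1 + rnorm x)) => k hk.
  rewrite -[T _ x](subrK x) (le_trans (rnormD _ _))// lerD2r ltW// hd//.
  case/andP: (hs k).1 => -> /= sk; apply: le_lt_trans sk _.
  rewrite -[d]invrK ltf_pV2 ?posrE ?invr_gt0//.
  by apply: lt_le_trans (truncnS_gt _) _; rewrite ler_nat (leq_trans hk).
have [_ [x hx]] := hs (Num.truncn C).+1.
have := lt_le_trans hx (hC _ x).
apply/negP; rewrite -leNgt ler_wpM2r ?rnorm_ge0// ltW//; exact: truncnS_gt.
Qed.

(* [u] is the Riemann-sum version of [q * \int_0^(1/q) T(s) x ds]: in
   [(T (1/n) - 1) u] the sums telescope up to two boundary terms. *)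
Lemma orbit_average (x : X) e : 0 < e -> exists u : X,
  rnorm (u - x) <= e /\
  exists K, forall n, rnorm (increment n%:R (T n%:R^-1) u) <= K.
Proof.
move=> e0; have [d [M [d0 M0 hM]]] := semigroup_local_bound.
have [d' d'0 hd'] := semigroup_right0 hT x e0.
(* [1/q < d'] keeps the average close to [x]; [2/q <= d] keeps the orbit under the local bound even
   after a shift by [1/n <= 1/q]. *)
pose q := (Num.truncn (2 / d + d'^-1)).+1.
have q0 : (0 : R) < q%:R by [].
have hq : 2 / d + d'^-1 < q%:R by exact: truncnS_gt.
have qd : 2 / q%:R <= d.
  rewrite ler_pdivrMr// mulrC -ler_pdivrMr//; apply: ltW; apply: le_lt_trans hq.
  by rewrite lerDl invr_ge0 ltW.
have qd' : q%:R^-1 < d'.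
  rewrite -[d']invrK ltf_pV2 ?posrE ?invr_gt0//; apply: le_lt_trans hq.
  by rewrite lerDr divr_ge0// ltW.
pose tau k : R := (q * k)%:R^-1.
have tau0 k : 0 <= tau k by rewrite invr_ge0.
pose U k := k%:R^-1 **: \sum_(j < k) T (j%:R * tau k) x.
have jtau j k : (0 < k)%N -> (j <= k)%N -> 0 <= j%:R * tau k <= q%:R^-1.
  move=> k0 jk; rewrite mulr_ge0//= /tau natrM invfM mulrCA ler_piMr ?invr_ge0//.
  by rewrite ler_pdivrMr ?ltr0n// mul1r ler_nat.
have Ux k : (0 < k)%N -> rnorm (U k - x) <= e.
  move=> k0; have kr : (0 : R) < k%:R by rewrite ltr0n.
  have -> : U k - x = k%:R^-1 **: \sum_(j < k) (T (j%:R * tau k) x - x).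
    rewrite sumrB scalerBr; congr (_ - _).
    by rewrite sumr_const card_ord (rscale_nat k x) rscalerA mulVf ?gt_eqF// rscale1r.
  rewrite rnormZ ger0_norm ?invr_ge0// ler_pdivrMl//.
  apply: le_trans (rnorm_sum _ _ _) _;
  rewrite -[k in leRHS]card_ord mulr_natl -sumr_const.
  apply: ler_sum => j _; apply: ltW; apply: hd'.
  have /andP[-> /=] := jtau j k k0 (ltnW (ltn_ord j)).
  by move=> /le_lt_trans; apply.
have Ucau ep : 0 < ep -> exists n0, forall k m, (n0 <= k)%N -> (0 < m)%N ->
    rnorm (U k - U (k * m)%N) < ep.
  move=> ep0; have e1 : 0 < ep / (M + 1) by rewrite divr_gt0// ltr_wpDl.
  have [d1 d10 hd1] := semigroup_right0 hT x e1.
  exists (Num.truncn d1^-1).+1 => k m hk m0.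
  have k0 : (0 < k)%N by apply: leq_trans hk.
  have kr : (0 : R) < k%:R by rewrite ltr0n.
  have mr : (0 : R) < m%:R by rewrite ltr0n.
  (* Each cell of the coarse grid is cut into [m] pieces. The factor [T (j%:R * tau k)] is bounded
     by [M], and what remains is the oscillation of the orbit near [0]. *)
  have -> : U k - U (k * m)%N = (k * m)%:R^-1 **:
      \sum_(j < k) \sum_(i < m) T (j%:R * tau k) (x - T (i%:R * tau (k * m)%N) x).
    rewrite /U (sum_mul (fun l => T (l%:R * tau (k * m)%N) x)).
    under [in RHS]eq_bigr do under eq_bigr do rewrite linearB.
    under [in RHS]eq_bigr do rewrite sumrB.
    rewrite sumrB scalerBr; congr (_ - _).
      under [in RHS]eq_bigr do rewrite sumr_const card_ord (rscale_nat m (T _ _)).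
      rewrite -scaler_sumr rscalerA natrM; congr (_ **: _).
      by field; rewrite !gt_eqF.
    congr (_ **: _); apply: eq_bigr => j _; apply: eq_bigr => i _.
    rewrite -(semigroupD hT) ?mulr_ge0//; congr (T _ x).
    rewrite natrD mulrDl natrM; congr (_ + _).
    by rewrite /tau !natrM; field; rewrite !gt_eqF.
  rewrite rnormZ ger0_norm ?invr_ge0// ltr_pdivrMl ?ltr0n ?muln_gt0 ?k0//.
  apply: le_lt_trans (_ : \sum_(j < k) \sum_(i < m) (M * (ep / (M + 1))) < _).
    apply: le_trans (rnorm_sum _ _ _) _; apply: ler_sum => j _.
    apply: le_trans (rnorm_sum _ _ _) _; apply: ler_sum => i _.
    apply: le_trans (hM _ _ _) _.
      have /andP[-> /= h] := jtau j k k0 (ltnW (ltn_ord j)).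
      by apply: le_trans h _; apply: le_trans qd; rewrite ler_peMl// ?invr_ge0// ler1n.
    rewrite ler_wpM2l// rnormBC ltW// hd1// mulr_ge0//=.
    apply: (@le_lt_trans _ _ k%:R^-1).
      rewrite /tau ler_pdivrMr ?ltr0n ?muln_gt0 ?k0// mulrC ler_pdivlMr//.
      rewrite -natrM ler_nat; apply: leq_trans (leq_mul (ltnW (ltn_ord i)) (leqnn k)) _.
      by rewrite mulnC leq_pmull.
    rewrite -[d1]invrK ltf_pV2 ?posrE ?invr_gt0//.
    by apply: lt_le_trans (truncnS_gt _) _; rewrite ler_nat.
  rewrite !sumr_const !card_ord -mulrnA -[ltLHS]mulr_natl [(m * k)%N]mulnC.
  rewrite ltr_pM2l ?ltr0n ?muln_gt0 ?k0// mulrCA -[ltRHS]mulr1.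
  rewrite ltr_pM2l// ltr_pdivrMr ?ltr_wpDl//.
  by rewrite mul1r ltrDl.
have [u Uu] := divisible_cauchy Ucau.
exists u; split.
  apply: (@ler_cvg0 _ _ (nbhs \oo) _ (fun k => rnorm (U k - u))); first exact/cvg_rnormP.
  exists 1%N => // k /= k0; rewrite [leRHS]addrC.
  apply: le_trans (rnorm_triangle (U k) _ _) _.
  by rewrite rnormBC lerD2l Ux.
apply: (@eventually_bounded _ _ q (2 * q%:R * M * rnorm x)) => n qn.
have n0 : (0 < n)%N by apply: leq_trans qn.
have nr : (0 : R) < n%:R by rewrite ltr0n.
have nq : n%:R^-1 <= q%:R^-1 :> R by rewrite lef_pV2 ?posrE// ler_nat.
set B := increment n%:R (T n%:R^-1).
have cB : continuous B.
  by apply: increment_continuous; apply: (semigroup_continuous hT); rewrite invr_ge0.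
have [M' M'0 hM'] := (linear_continuousP _).1 cB.
(* Along multiples [k = n * m] the time [1/n] is exactly [q * m] mesh widths [tau k], so shifting by
   it stays on the grid and [sum_shift] applies. *)
have sub : U (n * m)%N @[m --> \oo] --> u.
  apply: cvg_comp Uu => A [N _ hN]; exists N => // m /= Nm; apply: hN => /=.
  by apply: leq_trans Nm _; rewrite leq_pmull.
apply: (@ler_cvg0 _ _ (nbhs \oo) _ (fun m => M' * rnorm (U (n * m)%N - u))).
  rewrite -[0](mulr0 M'); apply: cvgM; first exact: cvg_cst.
  exact/cvg_rnormP.
exists 1%N => // m; rewrite [X in X -> _]/= => m0; set k := (n * m)%N.
have k0 : (0 < k)%N by rewrite muln_gt0 n0.
have kr : (0 : R) < k%:R by rewrite ltr0n.
have mr : (0 : R) < m%:R by rewrite ltr0n.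
have -> : B u = B (U k) + B (u - U k) by rewrite -(linearD B) addrC subrK.
apply: le_trans (rnormD _ _) _; apply: lerD; last first.
  by rewrite (rnormBC (U k)); exact: hM'.
have -> : B (U k) = n%:R **: (T n%:R^-1 (U k) - U k) by [].
rewrite rnormZ ger0_norm//.
have ptau : (q * m)%:R * tau k = n%:R^-1.
  by rewrite /tau /k !natrM; field; rewrite !gt_eqF.
have -> : T n%:R^-1 (U k) - U k = k%:R^-1 **: (\sum_(i < q * m)
    (T ((k + i)%:R * tau k) x - T (i%:R * tau k) x)).
  rewrite sumrB -(sum_shift (fun i => T (i%:R * tau k) x)) /U linearZ /=.
  rewrite -scalerBr linear_sum; congr (_ **: (_ - _)); apply: eq_bigr => j _.
  rewrite -(semigroupD hT) ?invr_ge0// ?mulr_ge0//; congr (T _ x).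
  by rewrite natrD mulrDl ptau addrC.
rewrite rnormZ ger0_norm ?invr_ge0//.
have hsum : rnorm (\sum_(i < q * m) (T ((k + i)%:R * tau k) x - T (i%:R * tau k) x))
   <= (q * m)%:R * (2 * M * rnorm x).
  apply: le_trans (rnorm_sum _ _ _) _.
  rewrite -[(q * m)%N in leRHS]card_ord mulr_natl -sumr_const.
  apply: ler_sum => i _; apply: le_trans (rnormB _ _) _.
  have iq : i%:R * tau k <= q%:R^-1.
    apply: le_trans nq; rewrite -ptau ler_wpM2r// ler_nat ltnW//.
  have -> : 2 * M * rnorm x = M * rnorm x + M * rnorm x by ring.
  have q2 : q%:R^-1 + q%:R^-1 <= d.
    by rewrite (_ : _ + _ = 2 / q%:R) //; ring.
  have q3 : (0 : R) <= q%:R^-1 by rewrite invr_ge0.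
  apply: lerD; apply: hM; rewrite mulr_ge0//=.
    rewrite natrD mulrDl; apply: le_trans q2; apply: lerD => //.
    by have /andP[_] := jtau k k k0 (leqnn k).
  lra.
apply: le_trans (ler_wpM2l (ltW nr) (ler_wpM2l _ hsum)) _; first by rewrite invr_ge0.
rewrite /k !natrM le_eqVlt; apply/orP; left; apply/eqP.
by field; rewrite !gt_eqF.
Qed.

End LocalBound.

(** * Complex functionals and rank-one projections *)

Section RankOne.
Variables (R : realType) (X : completeNormedModType R[i]).

Lemma cvg_rnorm_bounded (u : nat -> X) : cvgn u ->
  exists C, forall n, rnorm (u n) <= C.
Proof.
move=> /cvg_ex[l /cvg_rnormP/cvgrPdist_lt/(_ _ ltr01)[n0 _ h]].
apply: (@eventually_bounded _ _ n0 (1 + rnorm l)) => n hn.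
have := h n hn; rewrite /= sub0r normrN ger0_norm ?rnorm_ge0// => hl.
by rewrite -[u n](subrK l) (le_trans (rnormD _ _))// lerD2r ltW.
Qed.

Lemma bernoulli (x : R) n : 0 <= x -> 1 + n%:R * x <= (1 + x) ^+ n.
Proof.
move=> x0; elim: n => [|n IH]; first by rewrite mul0r addr0.
rewrite exprS; have h := ler_wpM2l (addr_ge0 ler01 x0) IH.
have h2 : 0 <= n%:R * (x * x) by rewrite !mulr_ge0.
by apply: le_trans h; rewrite -natr1; lra.
Qed.

(* The complex-linear functional with real part [r]. *)
Definition complexify (r : X -> R) (x : X) : R[i] :=
  (r x -i* r ('i%C *: x))%C.

Lemma complexify_linear r : real_linear r ->
  forall (c : R[i]) x y, complexify r (c *: x + y) = c * complexify r x + complexify r y.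
Proof.
move=> [rD rZ] [a b] x y.
have rN z : r (- z) = - r z by rewrite real_linearN.
have E (z : X) : Complex a b *: z = a **: z + b **: ('i%C *: z).
  rewrite scalerA -scalerDl; congr (_ *: _); apply/eqP.
  by rewrite eq_complex /=; apply/andP; split; apply/eqP; ring.
have iE (z : X) : 'i%C *: (a **: z + b **: ('i%C *: z)) = a **: ('i%C *: z) - b **: z.
  rewrite scalerDr !scalerA -scalerBl -scalerDl; congr (_ *: _); apply/eqP.
  by rewrite eq_complex /=; apply/andP; split; apply/eqP; ring.
apply/eqP; rewrite E eq_complex /= scalerDr iE !(rD, rN, rZ).
by apply/andP; split; apply/eqP; ring.
Qed.

Lemma complexify_bounded D r x : real_functional D r ->
  complex.Re `|complexify r x| <= 2 * D * rnorm x.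
Proof.
move=> [_ hr]; set a := r x; set b := r ('i%C *: x).
have ha : `|a| <= D * rnorm x by exact: hr.
have hb : `|b| <= D * rnorm x.
  apply: le_trans (hr _) _; rewrite rnorm_complexZ normc_def /=.
  by rewrite expr0n expr1n add0r sqrtr1 mul1r.
have hab : Num.sqrt (a ^+ 2 + (- b) ^+ 2) <= `|a| + `|b|.
  rewrite -[leRHS]ger0_norm ?addr_ge0// -sqrtr_sqr; apply: ler_wsqrtr.
  rewrite sqrrN sqrrD -(real_normK (num_real a)) -(real_normK (num_real b)).
  have : 0 <= `|a| * `|b| by rewrite mulr_ge0.
  lra.
rewrite normc_def /=; apply: le_trans hab _; lra.
Qed.

Lemma rank_one_projection (D : R) r (y : X) : 0 <= D -> real_functional D r ->
  complexify r y = 1 ->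
  exists2 P : {linear X -> X}, bounded_projection P &
    forall x, P x = complexify r x *: y.
Proof.
move=> D0 hr fy; have hl := complexify_linear hr.1.
have Plin : linear (fun x => complexify r x *: y).
  by move=> c x z; rewrite hl scalerDl scalerA.
pose P : {linear X -> X} := HB.pack (fun x => complexify r x *: y)
  (GRing.isLinear.Build _ _ _ _ _ Plin).
exists P => //; split=> [|x].
  apply/linear_continuousP; exists (2 * D * rnorm y).
    by rewrite !mulr_ge0 ?rnorm_ge0.
  move=> x; rewrite [P x]/(complexify r x *: y) rnorm_complexZ mulrAC.
  by rewrite ler_wpM2r ?rnorm_ge0// complexify_bounded.
rewrite /P /=; congr (_ *: _).
have f0 : complexify r 0 = 0.
  have := hl 0 y 0; rewrite scale0r add0r mul0r add0r => _.
  by have := hl 1 0 0; rewrite scale1r addr0 mul1r => /esym/eqP;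
    rewrite -subr_eq0 addrK => /eqP.
by have := hl (complexify r x) y 0; rewrite !addr0 fy mulr1 f0 addr0.
Qed.

(** [P] sends everything to a multiple of [y], so each further factor contributes the scalar
    [complexify r (S y)]. *)
Lemma complexify_iter r (y : X) (S P : {linear X -> X}) n :
  real_linear r -> complexify r y = 1 -> (forall x, P x = complexify r x *: y) ->
  complexify r (iter n (S \o P) y) = complexify r (S y) ^+ n.
Proof.
move=> hr fy PE; have hl := complexify_linear hr.
have f0 : complexify r 0 = 0.
  by have := hl 1 0 0; rewrite scale1r addr0 mul1r => /esym/eqP;
    rewrite -subr_eq0 addrK => /eqP.
elim: n => [//|n IH]; rewrite iterS /= PE linearZ /=.
by have := hl (complexify r (iter n (S \o P) y)) (S y) 0;
  rewrite !addr0 f0 addr0 => ->; rewrite IH exprS mulrC.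
Qed.

End RankOne.

(** * From convergent products to a bounded generator *)

Section Converse.
Variables (R : realType) (X : completeNormedModType R[i]).
Variables (T : R -> {linear X -> X}) (hT : is_C0_semigroup T).
Hypothesis product_cvg : forall P : {linear X -> X}, bounded_projection P ->
  forall x, cvgn (fun n : nat => iter n (T n%:R^-1 \o P) x).

Let B n : {linear X -> X} := increment n%:R (T n%:R^-1).

(** With [a = r (B n y) >= 0], the modulus of [z ^+ n] is at least [(1 + a/n)^n >= 1 + a] by
    Bernoulli, while the convergent products keep it bounded. A negative [a] lies below the
    nonnegative bound anyway. *)
Lemma increment_functional_bounded_normalized (D : R) r (y : X) :
  0 <= D -> real_functional D r -> complexify r y = 1 ->
  exists C, forall n, r (B n y) <= C.
Proof.
move=> D0 hr fy; have [P hP PE] := rank_one_projection D0 hr fy.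
have [K hK] := cvg_rnorm_bounded (@product_cvg P hP y).
have ry : r y = 1 by have /(congr1 (@complex.Re R)) := fy.
apply: (@eventually_bounded _ _ 1%N (2 * D * K)) => n n0.
have nr : (0 : R) < n%:R by rewrite ltr0n.
apply: (@le_trans _ _ (2 * D * rnorm (iter n (T n%:R^-1 \o P) y))); last first.
  by rewrite ler_wpM2l// mulr_ge0.
apply: le_trans (complexify_bounded _ hr).
rewrite complexify_iter//; last exact: hr.1.
set z := complexify r _.
have zE : complex.Re z = 1 + n%:R^-1 * r (B n y).
  rewrite -[LHS]/(r (T n%:R^-1 y)) (incrementK (T n%:R^-1) y n0).
  by rewrite hr.1.1 hr.1.2 ry.
have [a0|a0] := leP 0 (r (B n y)); last first.
  by apply: le_trans (ltW a0) _; exact: (@rnorm_ge0 R R[i]^o).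
have -> : complex.Re `|z ^+ n| = (complex.Re `|z|) ^+ n.
  have [m zm] : exists m : R, `|z| = (m%:C)%C by exact/complex_realP/normr_real.
  by rewrite normrX zm -rmorphXn.
have h1 : 1 + n%:R^-1 * r (B n y) <= complex.Re `|z|.
  rewrite -zE; apply: le_trans (ler_norm _) _; rewrite -lecR RRe_real//.
  exact: normc_ge_Re.
have h2 : 0 <= n%:R^-1 * r (B n y) by rewrite mulr_ge0// invr_ge0.
apply: le_trans (lerXn2r n _ _ h1); rewrite ?nnegrE ?addr_ge0//; last first.
  by apply: le_trans h1; rewrite addr_ge0.
apply: le_trans (bernoulli n h2); rewrite mulrA mulfV ?gt_eqF// mul1r.
by rewrite lerDr.
Qed.

Lemma increment_functional_bounded (D : R) r (y : X) : real_functional D r ->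
  exists C, forall n, r (B n y) <= C.
Proof.
move=> hr0; pose E := `|D|.
have hr : real_functional E r.
  split=> [|x]; first exact: hr0.1.
  by apply: le_trans (hr0.2 x) _; rewrite ler_wpM2r ?rnorm_ge0// ler_norm.
have E0 : 0 <= E by exact: normr_ge0.
have [[x0 rx0]|r0] := pselect (exists x, r x != 0); last first.
  exists 0 => n; rewrite le_eqVlt; apply/orP; left.
  by apply: contrapT => /negP h; apply: r0; exists (B n y).
(* This makes [E * e < |r x0|], so a vector [u] within [e] of [x0] cannot be annihilated by [r]. *)
pose e := `|r x0| / (2 * (E + 1)).
have e0 : 0 < e by rewrite divr_gt0 ?normr_gt0// mulr_gt0// ltr_wpDl.
have [u [ux [K hK]]] := orbit_average hT x0 e0.
have ru : r u != 0.
  apply/eqP => ru0; have := hr.2 (u - x0).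
  rewrite (real_linearB _ _ hr.1) ru0 sub0r normrN.
  move=> /le_trans/(_ (ler_wpM2l E0 ux)).
  have -> : `|r x0| = e * 2 * (E + 1).
    rewrite /e; field; rewrite gt_eqF// ltr_wpDl//.
  apply/negP; rewrite -ltNge.
  have : 0 <= e * E by rewrite mulr_ge0// ltW.
  by lra.
pose f := complexify r.
have fu : f u != 0.
  by apply: contra ru => /eqP/(congr1 (@complex.Re R))/= ->.
(* Adding [b *: u] to [y] normalises the functional to [1]; the correction [b *: B n u] is bounded
   in [n] by the choice of [u]. *)
pose b := (1 - f y) / f u.
have fyb : f (b *: u + y) = 1.
  by rewrite /f (complexify_linear hr.1) -/(f _) -/(f _) divfK// subrK.
have [C hC] := increment_functional_bounded_normalized E0 hr fyb.
exists (C + E * (complex.Re `|b| * K)) => n.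
have -> : B n y = B n (b *: u + y) - b *: B n u.
  by rewrite (linearD (B n)) (linearZ_LR (B n)) addrC addKr.
rewrite (real_linearB _ _ hr.1) lerD// lerNl.
have h := hr.2 (b *: B n u); rewrite ler_norml in h.
case/andP: h => h _; apply: le_trans h; rewrite lerN2 ler_wpM2l//.
rewrite rnorm_complexZ; apply: ler_wpM2l; last exact: hK.
exact: (@rnorm_ge0 R R[i]^o b).
Qed.

Lemma increment_uniformly_bounded :
  exists2 C, 0 <= C & forall n x, rnorm (B n x) <= C * rnorm x.
Proof.
apply: uniform_boundedness => [n|y].
  by apply: increment_continuous; apply: (semigroup_continuous hT); rewrite invr_ge0.
apply: weakly_bounded_bounded => D r hr.
(* The available bounds are one-sided; those for [r] and [- r] together control the absolute
   value. *)
have hrN : real_functional D (fun x => - r x).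
  split=> [|x]; last by rewrite normrN; exact: hr.2.
  by split=> [x z|a x]; rewrite ?hr.1.1 ?hr.1.2 ?opprD ?mulrN.
have [C1 h1] := increment_functional_bounded y hr.
have [C2 h2] := increment_functional_bounded y hrN.
exists (`|C1| + `|C2|) => n.
rewrite ler_norml; apply/andP; split.
  rewrite lerNl; apply: le_trans (h2 n) _.
  by apply: le_trans (ler_norm _) _; rewrite lerDr.
by apply: le_trans (h1 n) _; apply: le_trans (ler_norm _) _; rewrite lerDl.
Qed.

(* For real [h], use the grid points [hk n = k/n] decreasing to [h] and right
   continuity of the orbits. *)
Lemma semigroup_first_order : exists (A : X -> X) (C : R),
  [/\ 0 <= C, forall x, rnorm (A x) <= C * rnorm x &
  forall h x, 0 < h -> 2 * C * h <= 1 ->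
    rnorm (T h x - x - h **: A x) <= (2 * C * h) ^+ 2 * rnorm x].
Proof.
have [C C0 hC] := increment_uniformly_bounded.
have refine n m y : (0 < m)%N -> T n%:R^-1 y = iter m (T (n * m)%:R^-1) y.
  by move=> m0; have := semigroup_refine hT n y ler01 m0; rewrite !mul1r.
have /choice[A hA] : forall x, exists l : X, B n x @[n --> \oo] --> l.
  move=> x; apply: divisible_cauchy => e e0.
  have := cvg_divn (2 * C ^+ 2 * rnorm x) => /cvgrPdist_lt/(_ _ e0)[n0 _ hn0].
  exists n0.+1 => n m hn m0; apply: le_lt_trans (hn0 n (ltnW hn)).
  rewrite /= sub0r normrN; apply: le_trans (ler_norm _); rewrite mulrAC.
  apply: (@increment_diff R X (fun k => T k%:R^-1)) => //.
    by move=> z; exact: refine.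
  exact: leq_ltn_trans hn.
exists A, C; split=> // [x|h x h0 Ch].
  apply: (@ler_cvg0 _ _ (nbhs \oo) _ (fun n => rnorm (B n x - A x))).
    exact/cvg_rnormP.
  exists 0%N => // n _; apply: le_trans (_ : rnorm (A x - B n x) + rnorm (B n x) <= _).
    by apply: le_trans (rnormD _ _); rewrite subrK.
  by rewrite rnormBC addrC lerD2r hC.
have [M M0 hM] := (linear_continuousP _).1 (semigroup_continuous hT (ltW h0)).
pose k n := (Num.truncn (h * n%:R)).+1.
pose hk n : R := (k n)%:R / n%:R.
have hhk n : (0 < n)%N -> h < hk n <= h + 1 / n%:R.
  move=> n0; have nr : (0 : R) < n%:R by rewrite ltr0n.
  rewrite /hk ltr_pdivlMr// truncnS_gt/= ler_pdivrMr// mulrDl divfK ?gt_eqF//.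
  by rewrite /k -natr1 lerD2r truncn_le mulr_ge0// ltW.
(* The three errors come from replacing [T (hk n)] by [T h], [hk n] by [h], and [B n x] by its limit
   [A x]. *)
pose err n := M * rnorm (T (hk n - h) x - x) + (C * rnorm x) / n%:R +
  h * rnorm (B n x - A x).
have Tk : rnorm (T (hk n - h) x - x) @[n --> \oo] --> 0.
  apply/cvgrPdist_lt => e e0; have [d d0 hd] := semigroup_right0 hT x e0.
  exists (Num.truncn d^-1).+1 => // n /= hn.
  have n0 : (0 < n)%N by apply: leq_trans hn.
  have nr : (0 : R) < n%:R by rewrite ltr0n.
  rewrite sub0r normrN ger0_norm ?rnorm_ge0//; apply: hd.
  have /andP[h1 h2] := hhk n n0; rewrite subr_ge0 ltW//= ltrBlDl.
  apply: le_lt_trans h2 _; rewrite ltrD2l mul1r -[d]invrK ltf_pV2 ?posrE ?invr_gt0//.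
  by apply: lt_le_trans (truncnS_gt _) _; rewrite ler_nat.
apply: (@ler_cvg0 _ _ (nbhs \oo) _ err).
  rewrite /err -[0](_ : M * 0 + 0 + h * 0 = _); last by rewrite !mulr0 !addr0.
  apply: cvgD; first apply: cvgD.
  - by apply: cvgM => //; exact: cvg_cst.
  - exact: cvg_divn.
  - by apply: cvgM; [exact: cvg_cst|exact/cvg_rnormP].
exists (Num.truncn h^-1).+1 => // n; rewrite [X in X -> _]/= => hn.
have n0 : (0 < n)%N by apply: leq_trans hn.
have nr : (0 : R) < n%:R by rewrite ltr0n.
have nh : 1 / n%:R <= h.
  rewrite ler_pdivrMr// mulrC -ler_pdivrMr// mul1r; apply: ltW.
  by apply: lt_le_trans (truncnS_gt _) _; rewrite ler_nat.
have /andP[h1 h2] := hhk n n0.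
(* Rounding up may double [h], whence the factor [2] in [2 * C * h]. *)
have hk2 : hk n <= 2 * h by apply: le_trans h2 _; lra.
have Chk : (k n)%:R * (n%:R^-1 * C) = C * hk n by rewrite /hk; ring.
have Chk1 : C * hk n <= 2 * C * h by have := ler_wpM2l C0 hk2; lra.
pose b := ((n%:R^-1 : R)%:C)%C \*: B n : {linear X -> X}.
have hb y : rnorm (b y) <= n%:R^-1 * C * rnorm y.
  rewrite [b y]/(n%:R^-1 **: B n y) rnormZ ger0_norm ?invr_ge0// -mulrA.
  by rewrite ler_wpM2l ?invr_ge0.
have hb0 : 0 <= n%:R^-1 * C by rewrite mulr_ge0// invr_ge0.
have hb1 : (k n)%:R * (n%:R^-1 * C) <= 1 by rewrite Chk (le_trans Chk1).
have hk0 : 0 <= hk n by rewrite divr_ge0.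
have est : rnorm (T (hk n) x - x - hk n **: B n x) <= (2 * C * h) ^+ 2 * rnorm x.
  have := pow_estimate x hb0 hb hb1.
  have -> : iter (k n) (fun y => y + b y) x = T (hk n) x.
    rewrite /hk (semigroup_iter hT) ?invr_ge0//; apply: eq_iter => y.
    by rewrite [RHS](incrementK (T n%:R^-1) y n0).
  rewrite -[b x]/(n%:R^-1 **: B n x) rscalerA => /le_trans; apply.
  rewrite Chk ler_wpM2r ?rnorm_ge0// lerXn2r ?nnegrE ?mulr_ge0//.
  exact: ltW.
have e1 : rnorm (T h x - T (hk n) x) <= M * rnorm (T (hk n - h) x - x).
  have -> : T (hk n) x = T h (T (hk n - h) x).
    rewrite -(semigroupD hT) ?subr_ge0 ?ltW//; congr (T _ x); ring.
  by rewrite -linearB rnormBC; apply: le_trans (hM _); rewrite -rnormN -linearN opprB.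
have e2 : rnorm (hk n **: B n x - h **: A x) <=
    C * rnorm x / n%:R + h * rnorm (B n x - A x).
  have -> : hk n **: B n x - h **: A x = (hk n - h) **: B n x + h **: (B n x - A x).
    by rewrite rmorphB scalerBl scalerBr addrA subrK.
  apply: le_trans (rnormD _ _) _.
  rewrite (rnormZ (hk n - h)) (rnormZ h) (gtr0_norm h0) lerD2r.
  have hkh : 0 <= hk n - h by rewrite subr_ge0 ltW.
  rewrite (ger0_norm hkh) mulrC; apply: ler_pM => //; first exact: rnorm_ge0.
  by rewrite lerBlDl -[n%:R^-1]mul1r.
have -> : T h x - x - h **: A x = (T (hk n) x - x - hk n **: B n x) +
    ((T h x - T (hk n) x) + (hk n **: B n x - h **: A x)).
  rewrite [in RHS]addrA [X in _ = X + _]addrC.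
  rewrite -[T (hk n) x - x - _]addrA subrKA -!addrA; congr (_ + (_ + _)).
  by rewrite addKr.
apply: le_trans (rnormD _ _) _; apply: lerD => //.
by apply: le_trans (rnormD _ _) _; rewrite /err -addrA lerD.
Qed.

(** Dividing the quadratic first-order error by [h] leaves [4 * C ^+ 2 * h * rnorm x], so the
    difference quotient converges to [A x] for every [x]. *)
Lemma semigroup_generator_bounded : generator_bounded T.
Proof.
have [A [C [C0 hA hT1]]] := semigroup_first_order.
have cvA x : diffquot T x @ 0^'+ --> A x.
  apply/cvg_rnormP.
  apply: (@squeeze0 _ _ _ _ _ (fun h : R => h * (4 * C ^+ 2 * rnorm x))).
    apply/near_rightP; exists (2 * C + 1)^-1.
      by rewrite invr_gt0 ltr_wpDl// mulr_ge0.
    move=> h /andP[h0 hlt]; rewrite rnorm_ge0/=.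
    have Ch : 2 * C * h <= 1.
      have p : 0 < 2 * C + 1 by rewrite ltr_wpDl// mulr_ge0.
      have := ltW hlt; rewrite -[X in _ <= X]mul1r ler_pdivlMr// => hh; lra.
    have -> : diffquot T x h - A x = h^-1 **: (T h x - x - h **: A x).
      by rewrite /diffquot [RHS]scalerBr rscalerA mulVf ?gt_eqF// rscale1r.
    rewrite rnormZ gtr0_norm ?invr_gt0// ler_pdivrMl//.
    apply: le_trans (hT1 h x h0 Ch) _; rewrite le_eqVlt; apply/orP; left.
    by apply/eqP; ring.
  rewrite -[X in _ --> X](mul0r (4 * C ^+ 2 * rnorm x)).
  apply: cvgM; last exact: cvg_cst.
  exact: cvg_at_right_filter.
split.
  by apply/seteqP; split=> // x _; apply: cvgP (cvA x).
exists C => x; have -> : generator T x = A x by apply: cvg_lim => //; exact: cvA.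
by rewrite !normE -rmorphM lecR.
Qed.

End Converse.

Theorem theorem1 (R : realType) (X : completeNormedModType R[i])
  (T : R -> {linear X -> X}) (hT : is_C0_semigroup T) :
  generator_bounded T <->
  (forall P : {linear X -> X}, bounded_projection P ->
     forall (x : X) (t : R), 0 <= t ->
       cvgn (fun n : nat => iter n (T (t / n%:R) \o P) x)).
Proof.
split=> [[dT _] P hP x t t0|h]; first exact: projected_product_cvg.
apply: semigroup_generator_bounded => // P hP x.
by have := h P hP x 1 ler01; under eq_fun do rewrite mul1r.
Qed.
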